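(* Let $\mathcal F\subseteq L^2(\mathrm P)$ be a measurable class of functions such that the generative bootstrap process $\tilde{\mathbb G}_n$ is well defined as an $\ell^\infty(\mathcal F)$-valued random element for every $n$. Then $$\sup_{h\in \mathrm{BL}_1(\ell^\infty(\mathcal F),\|\cdot\|_{\mathcal F})}\Big|\mathrm E_{\tilde U}\big[h(\tilde{\mathbb G}_n)\mid\mathcal O\big]-\mathrm E\big[h(\mathbb G_{\mathrm P})\big]\Big|=o_{\mathrm P_{\mathcal O}}(1)$$ if and only if both of the following conditions hold: (i) (finite-dimensional conditional weak convergence) for every $k\in\mathbb N$ and $f_1,\dots,f_k\in\mathcal F$, $$\sup_{h\in \mathrm{BL}_1(\mathbb R^k,\|\cdot\|_\infty)}\Big|\mathrm E_{\tilde U}\big[h(\tilde{\mathbb G}_n[f_1],\dots,\tilde{\mathbb G}_n[f_k])\mid\mathcal O\big]-\mathrm E\big[h(\mathbb G_{\mathrm P}[f_1],\dots,\mathbb G_{\mathrm P}[f_k])\big]\Big|=o_{\mathrm P_{\mathcal O}}(1);$$ (ii) (conditional asymptotic $\rho_{\mathrm P}$-equicontinuity) for every $\epsilon,\eta>0$, $$\lim_{\delta\downarrow0}\limsup_{n\to\infty}\mathrm P_{\mathcal O}\Big\{\mathrm P_{\tilde U}\Big(\sup_{f,g\in\mathcal F:\ \rho_{\mathrm P}(f,g)<\delta}\big|\tilde{\mathbb G}_n[f]-\tilde{\mathbb G}_n[g]\big|>\epsilon\ \Big|\ \mathcal O\Big)>\eta\Big\}=0.$$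
   Context: Setting. $\mathrm P$ is a Borel probability measure on $\mathbb R^p$ and $Z_1,\dots,Z_n$ are i.i.d. from $\mathrm P$. $\mathrm P_U$ is a known base probability distribution. For each $n$, $\hat G_n$ is a (random) fitted generator mapping the base space into $\mathbb R^p$; $\mathcal O$ (depending on $n$) denotes all information (the induced $\sigma$-field) used to construct $\hat G_n$, including $Z_1,\dots,Z_n$ and any auxiliary training randomness, and $\mathrm P_{\mathcal O}$ is the induced probability on it. $\mathrm Q_n:=\hat G_n\#\mathrm P_U$ (pushforward) is the learned, random, probability measure on $\mathbb R^p$. Conditionally on $\mathcal O$, $\tilde Z_i=\hat G_n(\tilde U_i)$, $i=1,\dots,n$, with $\tilde U_i$ i.i.d. from $\mathrm P_U$, so that $\tilde Z_1,\dots,\tilde Z_n$ are i.i.d. from $\mathrm Q_n$. $\mathrm E_{\tilde U}[\cdot\mid\mathcal O]$ and $\mathrm P_{\tilde U}(\cdot\mid\mathcal O)$ are conditional expectation and probability with respect to the bootstrap randomness only. $\tilde{\mathbb P}_n:=n^{-1}\sum_{i=1}^n\delta_{\tilde Z_i}$, and the generative bootstrap process is $\tilde{\mathbb G}_n[f]:=\sqrt n(\tilde{\mathbb P}_n-\mathrm Q_n)f$, $f\in\mathcal F$. Notation. For a measure $\mu$, $\mu f=\mu[f]=\int f\,d\mu$. $o_{\mathrm P_{\mathcal O}}(1)$ means convergence to $0$ in $\mathrm P_{\mathcal O}$-probability as $n\to\infty$. $\ell^\infty(\mathcal F)$ is the space of bounded functions $x:\mathcal F\to\mathbb R$ with norm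 $\|x\|_{\mathcal F}=\sup_{f\in\mathcal F}|x[f]|$. For a metric space $(\mathbb D,d)$, $\mathrm{BL}_1(\mathbb D,d)$ is the set of $h:\mathbb D\to\mathbb R$ with $\sup_x|h(x)|\le1$ and $|h(x_1)-h(x_2)|\le d(x_1,x_2)$ for all $x_1,x_2$. $\rho_{\mathrm Q}(f,g)^2:=\mathrm Q[\{(f-g)-\mathrm Q[f-g]\}^2]$ for a probability measure $\mathrm Q$ with $\mathcal F\subseteq L^2(\mathrm Q)$. $\mathbb G_{\mathrm P}$ is the $\mathrm P$-Brownian bridge indexed by $\mathcal F$: the centered Gaussian process with covariance $\mathrm E[\mathbb G_{\mathrm P}[f]\mathbb G_{\mathrm P}[g]]=\mathrm P[fg]-\mathrm P[f]\mathrm P[g]$. Standing assumptions. $\mathbb G_{\mathrm P}$ is a tight, separable, Borel random element of $\ell^\infty(\mathcal F)$. The standard measurability conditions are imposed so that all suprema, conditional expectations and conditional probabilities appearing are measurable. *)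

(* Defs.v *)
From HB Require Import structures.
From mathcomp Require Import all_boot all_order all_algebra.
From mathcomp Require Import all_classical all_reals all_analysis.

Set Implicit Arguments.
Unset Strict Implicit.
Unset Printing Implicit Defensive.
Import Order.TTheory GRing.Theory Num.Theory.
Import numFieldNormedType.Exports.
Local Open Scope classical_set_scope.
Local Open Scope ring_scope.

Notation borel T := (g_sigma_algebraType (@open T)).

Section linfty.
Context {R : realType} {T : Type}.

Definition bounded_function : {pred T -> R} :=
  fun x => `[< [bounded x t | t in [set: T]] >].

Lemma bounded_functionP (x : T -> R) :
  reflect (exists M, forall t, `|x t| <= M) (x \in bounded_function).
Proof.
apply: (iffP idP) => [/asboolP [M [_ xM]]|[M xM]].
  by exists (M + 1) => t; apply: (xM (M + 1)) => //; rewrite ltrDl.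
apply/asboolP; exists M; split; first exact: num_real.
by move=> N MN t _; apply: le_trans (ltW MN).
Qed.

Fact bounded_function_submod_closed : submod_closed bounded_function.
Proof.
split=> [|a x y /bounded_functionP[M xM] /bounded_functionP[N yN]].
  by apply/bounded_functionP; exists 0 => t; rewrite normr0.
apply/bounded_functionP; exists (`|a| * M + N) => t.
rewrite (le_trans (ler_normD _ _))// lerD// normrM.
by rewrite ler_wpM2l.
Qed.

HB.instance Definition _ := GRing.isSubmodClosed.Build R (T -> R)
  bounded_function bounded_function_submod_closed.

Record linfty := Linfty {
  linfty_fun :> T -> R;
  linfty_funP : linfty_fun \in bounded_function }.

HB.instance Definition _ := [isSub for linfty_fun].
HB.instance Definition _ := [Choice of linfty by <:].
HB.instance Definition _ := [SubChoice_isSubLmodule of linfty by <:].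

Definition linfty_norm (x : linfty) : R := sup [set `|x t| | t in [set: T]].

Lemma linfty_has_ubound (x : linfty) : has_ubound [set `|x t| | t in [set: T]].
Proof.
have /bounded_functionP[M xM] := linfty_funP x.
by exists M => _ [t _ <-].
Qed.

Lemma linfty_norm_ub (x : linfty) t : `|x t| <= linfty_norm x.
Proof. by apply: ub_le_sup; [exact: linfty_has_ubound|exists t]. Qed.

Lemma linfty_norm_ge0 (x : linfty) : 0 <= linfty_norm x.
Proof.
have [x0|/set0P[_ [t _ _]]] := eqVneq [set `|x t| | t in [set: T]] set0.
  by rewrite /linfty_norm x0 sup0.
exact: le_trans (linfty_norm_ub x t).
Qed.

Lemma linfty_norm_le (x : linfty) M :
  0 <= M -> (forall t, `|x t| <= M) -> linfty_norm x <= M.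
Proof.
move=> M0 xM; rewrite /linfty_norm.
have [->|x0] := eqVneq [set `|x t| | t in [set: T]] set0; first by rewrite sup0.
by apply: ge_sup; [exact/set0P|move=> _ [t _ <-]].
Qed.

Lemma linfty_normD x y : linfty_norm (x + y) <= linfty_norm x + linfty_norm y.
Proof.
apply: linfty_norm_le => [|t]; first by rewrite addr_ge0// linfty_norm_ge0.
by rewrite (le_trans (ler_normD _ _))// lerD// linfty_norm_ub.
Qed.

Lemma linfty_normZ (a : R) x : linfty_norm (a *: x) = `|a| * linfty_norm x.
Proof.
have le b y : linfty_norm (b *: y) <= `|b| * linfty_norm y.
  apply: linfty_norm_le => [|t]; first by rewrite mulr_ge0// linfty_norm_ge0.
  by rewrite [X in `|X|](_ : _ = b * y t)// normrM ler_wpM2l// linfty_norm_ub.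
apply/eqP; rewrite eq_le le/=.
have [->|a0] := eqVneq a 0; first by rewrite normr0 mul0r linfty_norm_ge0.
rewrite -ler_pdivlMl ?normr_gt0// -normfV.
by rewrite -{1}(scale1r x) -(mulVf a0) -scalerA.
Qed.

Lemma linfty_norm0_eq0 x : linfty_norm x = 0 -> x = 0.
Proof.
move=> x0; apply/val_inj/funext => t; apply/eqP.
by rewrite -normr_le0 -x0 linfty_norm_ub.
Qed.

HB.instance Definition _ :=
  Lmodule_isNormed.Build R linfty linfty_normD linfty_normZ linfty_norm0_eq0.

Definition marginal k (f : 'I_k -> T) (x : linfty) : 'rV[R]_k :=
  \row_(i < k) x (f i).

End linfty.
Arguments linfty : clear implicits.

Section bounded_lipschitz.
Context {R : realType}.

Definition BL1 (D : Type) (d : D -> D -> R) : set (D -> R) :=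
  [set h | (forall x, `|h x| <= 1) /\
           (forall x y, `|h x - h y| <= d x y)].

Definition norm_dist (V : normedModType R) (x y : V) : R := `|x - y|.

(* Bounded Lipschitz distance between the laws of X and Y. The norm of
   [linfty R T] is the supremum norm, and so is the library's norm of 'rV[R]_k.
   For Borel measurable X and Y, the set under [sup] contains 0 and is bounded
   by 2. When X depends on a parameter w in Omega, the integral over T1 with w
   fixed is the conditional expectation given the sigma-field of Omega. *)
Definition BL_dist (V : normedModType R)
    d1 (T1 : measurableType d1) (mu : probability T1 R) (X : T1 -> V)
    d2 (T2 : measurableType d2) (nu : probability T2 R) (Y : T2 -> V) : R :=
  sup [set `| \int[mu]_t h (X t) - \int[nu]_t h (Y t) |
      | h in BL1 (@norm_dist V)].

End bounded_lipschitz.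

Section probability_notions.
Context {R : realType}.

Definition iid d (T : measurableType d) (PT : probability T R)
    dE (E : measurableType dE) (mu : probability E R)
    n (X : 'I_n -> T -> E) : Prop :=
  [/\ forall i, measurable_fun setT (X i),
      forall i A, measurable A -> PT (X i @^-1` A) = mu A &
      forall (J : {set 'I_n}) (A : 'I_n -> set E),
        (forall i, measurable (A i)) ->
        PT (\bigcap_(i in [set i | i \in J]) (X i @^-1` A i)) =
        (\prod_(i in J) PT (X i @^-1` A i))%E].

(* X_n = o_P(1), where X_n lives on its own probability space (Omega n, P n). *)
Definition op1 (d : nat -> measure_display)
    (Omega : forall n, measurableType (d n))
    (P : forall n, probability (Omega n) R) (X : forall n, Omega n -> R) : Prop :=
  forall eps : R, 0 < eps ->
    P n [set w | eps < `|X n w|] @[n --> \oo] --> 0%E.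

(* The library's [normal_prob m 0] is not the point mass at m. *)
Definition gaussian d (T : measurableType d) (PT : probability T R)
    (X : T -> R) : Prop :=
  measurable_fun setT X /\
  exists m s : R, forall A, measurable A ->
    PT (X @^-1` A) = if s == 0 then \d_m A else normal_prob m s A.

Definition gaussian_process d (T : measurableType d) (PT : probability T R)
    (I : Type) (X : I -> T -> R) : Prop :=
  forall k (a : 'I_k -> R) (i : 'I_k -> I),
    gaussian PT (fun t => \sum_(j < k) a j * X (i j) t).

Definition tight_rv d (T : measurableType d) (PT : probability T R)
    (V : normedModType R) (X : T -> V) : Prop :=
  forall eps : R, 0 < eps ->
    exists2 K : set V, compact K & ((1 - eps)%:E <= PT (X @^-1` K))%E.

(* The law of X is concentrated on a (closed) separable subset of V. *)
Definition separable_rv d (T : measurableType d) (PT : probability T R)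
    (V : normedModType R) (X : T -> V) : Prop :=
  exists2 D : set V, countable D & PT (X @^-1` closure D) = 1%E.

End probability_notions.

Section generative_bootstrap.
Context {R : realType} {p : nat}.
Local Notation Rp := (borel 'rV[R]_p).

Definition rho (P : probability Rp R) (f g : Rp -> R) : R :=
  Num.sqrt (\int[P]_x ((f x - g x) - \int[P]_y (f y - g y)) ^+ 2).

Definition brownian_bridge (P : probability Rp R) (F : set (Rp -> R))
    d (T : measurableType d) (PT : probability T R)
    (X : T -> linfty R F) : Prop :=
  [/\ gaussian_process PT (fun (f : F) t => X t f),
      forall f : F, ('E_PT[fun t => X t f] = 0)%E &
      forall f g : F, ('E_PT[fun t => (X t f * X t g)%R] =
        (\int[P]_x (val f x * val g x) -
         (\int[P]_x val f x) * (\int[P]_x val g x))%R%:E)%E].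

Context {dU : measure_display} {U : measurableType dU}.

Definition generated_law (PU : probability U R) (G : U -> Rp)
  : set Rp -> \bar R := pushforward PU G.

Definition empirical n (z : 'I_n -> Rp) (f : Rp -> R) : R :=
  n%:R^-1 * \sum_(i < n) f (z i).

Definition bootstrap_process (PU : probability U R) (G : U -> Rp)
    n (u : 'I_n -> U) (f : Rp -> R) : R :=
  Num.sqrt n%:R * (empirical (fun i => G (u i)) f -
    fine (\int[generated_law PU G]_z (f z)%:E)%E).

(* The set under [sup] is bounded by 2 * `|x|; for 0 < delta it is empty
   only if F is, and then the value is 0. *)
Definition modulus (P : probability Rp R) (F : set (Rp -> R))
    (delta : R) (x : linfty R F) : R :=
  sup [set `|x fg.1 - x fg.2| |
      fg in [set fg : F * F | rho P (val fg.1) (val fg.2) < delta]].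

End generative_bootstrap.

(* Main.v *)
(* Forward direction: marginals are 1-Lipschitz, which gives (i). For (ii), a
   Lipschitz cutoff of the rho_P-modulus is tested against both laws, which
   reduces the claim to the modulus of the bridge G_P being small in
   probability. Tightness provides a finite net of a compact set of large
   probability; near a net point y whose ball has positive probability,
   Chebyshev's inequality and E (G_P f - G_P g)^2 = rho_P(f, g)^2 force y to be
   uniformly rho_P-continuous up to the radius of the balls, and the other balls
   are null.

   Backward direction: the same finite net splits F into finitely many cells on
   which G_P oscillates little with probability at least 1/2. Since the increments
   are Gaussian, this bounds their variance rho_P^2, so F is totally bounded for
   rho_P. Replacing each f by a nearby net point f_i then costs only the moduli of
   both processes, and the laws on (f_1, ..., f_k) are compared by (i). *)

Require Import Defs.
From mathcomp Require Import all_boot all_order all_algebra.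
From mathcomp Require Import all_classical all_reals all_analysis.
From mathcomp Require Import measurable_realfun.
From mathcomp Require Import ring lra.

Set Implicit Arguments.
Unset Strict Implicit.
Unset Printing Implicit Defensive.
Import Order.TTheory GRing.Theory Num.Theory.
Import numFieldNormedType.Exports.
Local Open Scope classical_set_scope.
Local Open Scope ring_scope.

(** * Lipschitz maps and Borel measurability *)

Section bounded_lipschitz_distance.
Context {R : realType}.

Lemma lipschitz_continuous (V W : normedModType R) (h : V -> W) (c : R) :
  (forall x y, `|h x - h y| <= c * `|x - y|) -> continuous h.
Proof.
move=> hc x; apply/cvgrPdist_lt => e e0; near=> y.
(* [c] may be zero or negative, so [|c| + 1] replaces it as a constant that can be divided by. *)
have c1 : 0 < `|c| + 1 by rewrite ltr_wpDl.
apply: le_lt_trans (hc x y) _.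
apply: (@le_lt_trans _ _ ((`|c| + 1) * `|x - y|)).
  by rewrite ler_wpM2r// (le_trans (ler_norm c))// lerDl.
rewrite mulrC -ltr_pdivlMr//; near: y.
by apply: cvgr_dist_lt => //; rewrite divr_gt0.
Unshelve. all: by end_near. Qed.

(** The sigma-algebra of [R] is generated by open intervals, and a continuous map pulls these back
    to open sets. Evaluations, distances and moduli all get their measurability from here. *)
Lemma lipschitz_measurable (V : normedModType R) (h : V -> R) (c : R) :
  (forall x y, `|h x - h y| <= c * `|x - y|) ->
  measurable_fun setT (h : borel V -> R).
Proof.
move=> /lipschitz_continuous hcont.
apply: (measurability _ (RGenOpens.measurableE R)) => _ [_ [a [b ->] <-]].
rewrite setTI; apply: sub_sigma_algebra.
by move/continuousP : hcont; apply; exact: interval_open.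
Qed.

Lemma lipschitz_borel_measurable (V W : normedModType R) (h : V -> W) (c : R) :
  (forall x y, `|h x - h y| <= c * `|x - y|) ->
  measurable_fun setT (h : borel V -> borel W).
Proof.
move=> /lipschitz_continuous hcont.
apply: (@measurability _ _ (borel V) (borel W) setT h (@open W)) => // _ [A oA <-].
rewrite setTI; apply: sub_sigma_algebra.
by move/continuousP : hcont; apply.
Qed.

Lemma measurable_ler d (T : measurableType d) (f g : T -> R) :
  measurable_fun setT f -> measurable_fun setT g ->
  measurable [set t | f t <= g t].
Proof.
by move=> mf mg; rewrite -[X in measurable X]setTI; exact: measurable_fun_le.
Qed.

Lemma measurable_ltr d (T : measurableType d) (f g : T -> R) :
  measurable_fun setT f -> measurable_fun setT g ->
  measurable [set t | f t < g t].
Proof.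
move=> mf mg; rewrite (_ : [set t | _] = ~` [set t | g t <= f t]).
  by apply: measurableC; exact: measurable_ler.
by apply/seteqP; split => t /=; rewrite ltNge => /negP.
Qed.

(** * Integrals of bounded functions under a probability *)

Section prob.
Context d (T : measurableType d) (mu : probability T R).

Lemma bounded_integrable (f : T -> R) (M : R) :
  measurable_fun setT f -> (forall t, `|f t| <= M) ->
  mu.-integrable setT (EFin \o f).
Proof.
move=> mf fM; apply: (@le_integrable _ _ _ mu _ _ _ (EFin \o cst M)) => //.
- exact/measurable_EFinP.
- by move=> t _ /=; rewrite lee_fin (le_trans (fM t))// ler_norm.
- exact: finite_measure_integrable_cst.
Qed.

Lemma Rintegral_bound (f : T -> R) (M : R) :
  measurable_fun setT f -> (forall t, `|f t| <= M) ->
  `|\int[mu]_t f t| <= M.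
Proof.
move=> mf fM.
have fi := bounded_integrable mf fM.
apply: (le_trans (le_normr_Rintegral _ fi)) => //.
apply: (@le_trans _ _ (\int[mu]_t M)).
  apply: le_Rintegral => //; last exact: finite_measure_integrable_cst.
  by apply: (bounded_integrable (M := M)); [exact: measurableT_comp|
    move=> t; rewrite normr_id].
by rewrite Rintegral_cst//= probability_setT mulr1.
Qed.

Lemma Rintegral_cst_indic (c : R) (A : set T) : measurable A ->
  mu.-integrable setT (fun t => (c * \1_A t)%:E) /\
  \int[mu]_t (c * \1_A t) = c * fine (mu A).
Proof.
move=> mA; have iA : mu.-integrable setT (EFin \o \1_A).
  apply: (bounded_integrable (M := 1)) => // t.
  by rewrite indicE; case: (t \in A); rewrite ?normr1 ?normr0.
split; first by under eq_fun do rewrite EFinM; exact: integrableZl.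
by rewrite RintegralZl// /Rintegral integral_indic// setIT.
Qed.

Lemma Rintegral_ge_on (f : T -> R) (c M : R) (A : set T) :
  measurable A -> measurable_fun setT f -> (forall t, `|f t| <= M) ->
  (forall t, 0 <= f t) -> (forall t, A t -> c <= f t) ->
  c * fine (mu A) <= \int[mu]_t f t.
Proof.
move=> mA mf fM f0 cf; have [iA <-] := Rintegral_cst_indic c mA.
apply: le_Rintegral => //; first exact: bounded_integrable fM.
move=> t _; rewrite indicE; have [|_] := boolP (t \in A); last by rewrite mulr0.
by rewrite inE mulr1; exact: cf.
Qed.

Lemma Rintegral_le_on (f : T -> R) (c M : R) (A : set T) :
  measurable A -> measurable_fun setT f -> (forall t, `|f t| <= M) ->
  (forall t, f t <= c) -> (forall t, ~ A t -> f t <= 0) ->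
  \int[mu]_t f t <= c * fine (mu A).
Proof.
move=> mA mf fM fc f0; have [iA <-] := Rintegral_cst_indic c mA.
apply: le_Rintegral => //; first exact: bounded_integrable fM.
move=> t _; rewrite indicE; have [|] := boolP (t \in A); first by rewrite mulr1.
by rewrite notin_setE mulr0; exact: f0.
Qed.

(** The difference is dominated by [e + M *+ 2 * \1_A]: closeness off the exceptional set, the crude
    bound on it. *)
Lemma Rintegral_dist_le (f g : T -> R) (M e : R) (A : set T) :
  measurable A -> 0 <= e -> 0 <= M ->
  measurable_fun setT f -> measurable_fun setT g ->
  (forall t, `|f t| <= M) -> (forall t, `|g t| <= M) ->
  (forall t, ~ A t -> `|f t - g t| <= e) ->
  `|\int[mu]_t f t - \int[mu]_t g t| <= e + M *+ 2 * fine (mu A).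
Proof.
move=> mA e0 M0 mf mg fM gM fge.
have fi := bounded_integrable mf fM.
have gi := bounded_integrable mg gM.
have mfg : measurable_fun setT (fun t => f t - g t) by exact: measurable_funB.
have fgM t : `|f t - g t| <= M *+ 2.
  by rewrite (le_trans (ler_normB _ _))// mulr2n lerD.
rewrite -RintegralB//.
apply: (le_trans (le_normr_Rintegral _ (bounded_integrable mfg fgM))) => //.
apply: (@le_trans _ _ (\int[mu]_t (e + M *+ 2 * \1_A t))).
  apply: le_Rintegral => //.
  - apply: (bounded_integrable (M := M *+ 2)); first exact: measurableT_comp.
    by move=> t; rewrite normr_id.
  - apply: (bounded_integrable (M := e + M *+ 2)).
      by apply: measurable_funD => //; apply: measurable_funM.
    move=> t; rewrite ger0_norm ?addr_ge0 ?mulr_ge0// ?mulrn_wge0//.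
    by rewrite lerD2l ler_piMr// ?mulrn_wge0// indicE.
  - move=> t _; rewrite indicE; have [At|] := boolP (t \in A).
      by rewrite mulr1 (le_trans (fgM t))// lerDr.
    rewrite notin_setE => At; rewrite mulr0 addr0.
    by apply: fge.
have [iA intA] := Rintegral_cst_indic (M *+ 2) mA.
rewrite RintegralD//=; last exact: finite_measure_integrable_cst.
by rewrite Rintegral_cst//= probability_setT mulr1 intA.
Qed.

End prob.

(** * Bounded Lipschitz test functions and the distance between laws *)

Lemma BL1_0 (V : normedModType R) : BL1 (@norm_dist R V) (fun=> 0).
Proof. by split=> [x|x y]; rewrite /norm_dist ?subrr normr0. Qed.

Lemma BL1_measurable (V : normedModType R) (h : V -> R) :
  BL1 (@norm_dist R V) h -> measurable_fun setT (h : borel V -> R).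
Proof.
by move=> [_ hl]; apply: (lipschitz_measurable (c := 1)) => x y; rewrite mul1r.
Qed.

Lemma BL1_comp_measurable (V : normedModType R) (h : V -> R)
    d (T : measurableType d) (X : T -> V) :
  BL1 (@norm_dist R V) h -> measurable_fun setT (X : T -> borel V) ->
  measurable_fun setT (fun t => h (X t)).
Proof. by move=> /BL1_measurable mh mX; exact: (measurableT_comp mh mX). Qed.

Section BL.
Context (V : normedModType R) d1 (T1 : measurableType d1)
  (mu : probability T1 R) (X : T1 -> V) d2 (T2 : measurableType d2)
  (nu : probability T2 R) (Y : T2 -> V).
Hypothesis mX : measurable_fun setT (X : T1 -> borel V).
Hypothesis mY : measurable_fun setT (Y : T2 -> borel V).

(** By convention [sup] is 0 on a set without upper bound, so this is what makes [BL_dist] dominate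
    every test integral. Measurability of [X] and [Y] enters through the integral bound. *)
Lemma BL_dist_has_ubound :
  has_ubound [set `| \int[mu]_t h (X t) - \int[nu]_t h (Y t) |
             | h in BL1 (@norm_dist R V)].
Proof.
exists 2 => _ [h hBL <-].
rewrite (le_trans (ler_normB _ _))// (_ : 2 = 1 + 1)//.
have [h1 _] := hBL.
by apply: lerD; apply: Rintegral_bound => //; exact: BL1_comp_measurable.
Qed.

Lemma BL_dist_ge (h : V -> R) : BL1 (@norm_dist R V) h ->
  `| \int[mu]_t h (X t) - \int[nu]_t h (Y t) | <= BL_dist mu X nu Y.
Proof. by move=> hBL; apply: (ub_le_sup BL_dist_has_ubound); exists h. Qed.

Lemma BL_dist_ge0 : 0 <= BL_dist mu X nu Y.
Proof. exact: le_trans (BL_dist_ge (BL1_0 V)). Qed.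

Lemma BL_dist_le (c : R) :
  (forall h, BL1 (@norm_dist R V) h ->
    `| \int[mu]_t h (X t) - \int[nu]_t h (Y t) | <= c) ->
  BL_dist mu X nu Y <= c.
Proof.
move=> hc; apply: ge_sup; last by move=> _ [h /hc ? <-].
by exists `|\int[mu]_t 0 - \int[nu]_t 0|, (fun=> 0) => //; exact: BL1_0.
Qed.

(** Precomposing a test function on [W] with the contraction [phi] gives a test function on [V], so
    the left supremum runs over fewer values. *)
Lemma BL_dist_comp (W : normedModType R) (phi : V -> W) :
  (forall x y, `|phi x - phi y| <= `|x - y|) ->
  BL_dist mu (phi \o X) nu (phi \o Y) <= BL_dist mu X nu Y.
Proof.
move=> phil; apply: ge_sup.
  by exists `|\int[mu]_t 0 - \int[nu]_t 0|, (fun=> 0) => //; exact: BL1_0.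
move=> _ [h [h1 hl] <-]; apply: (@BL_dist_ge (h \o phi)); split.
  by move=> x; exact: h1.
by move=> x y; apply: (le_trans (hl _ _)); exact: phil.
Qed.

End BL.
End bounded_lipschitz_distance.

(** * Sup norms, marginals and step functions *)

Section linfty_space.
Context {R : realType} {T : Type}.
Implicit Types x y : linfty R T.

Lemma linfty_eval_norm x t : `|x t| <= `|x|.
Proof. exact: linfty_norm_ub. Qed.

Lemma linfty_eval_lipschitz x y t : `|x t - y t| <= `|x - y|.
Proof. exact: (linfty_eval_norm (x - y) t). Qed.

Lemma linfty_dist_le x y M :
  0 <= M -> (forall t, `|x t - y t| <= M) -> `|x - y| <= M.
Proof. by move=> M0 xyM; exact: (linfty_norm_le (x := x - y) M0 xyM). Qed.

Lemma rV_norm_le k (v : 'rV[R]_k) M :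
  0 <= M -> (forall i, `|v 0 i| <= M) -> `|v| <= M.
Proof.
move=> M0 vM; rewrite /Num.norm/= mx_normrE.
by apply: bigmax_le => // -[i j] _ /=; rewrite (ord1 i).
Qed.

Lemma rV_coord_norm k (v : 'rV[R]_k) i : `|v 0 i| <= `|v|.
Proof.
rewrite [leRHS]/Num.norm/= mx_normrE.
exact: (le_bigmax 0 (fun ij : 'I_1 * 'I_k => `|v ij.1 ij.2|) (0, i)).
Qed.

Lemma marginal_lipschitz k (f : 'I_k -> T) x y :
  `|marginal f x - marginal f y| <= `|x - y|.
Proof.
apply: rV_norm_le => // i; rewrite !mxE; exact: linfty_eval_lipschitz.
Qed.

Lemma step_bounded k (c : T -> 'I_k) (v : 'rV[R]_k) :
  (fun t => v 0 (c t)) \in bounded_function.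
Proof. by apply/bounded_functionP; exists `|v| => t; exact: rV_coord_norm. Qed.

(** Lifts a vector back to a bounded function that is constant on the cells of [c]. Composed with
    [marginal f], it replaces the value at [t] by the value at the representative [f (c t)]; being a
    contraction, it turns test functions on [linfty] into test functions on vectors. *)
Definition step k (c : T -> 'I_k) (v : 'rV[R]_k) : linfty R T :=
  Linfty (step_bounded c v).

Lemma step_lipschitz k (c : T -> 'I_k) (v w : 'rV[R]_k) :
  `|step c v - step c w| <= `|v - w|.
Proof.
apply: linfty_dist_le => // t /=.
by have := rV_coord_norm (v - w) (c t); rewrite !mxE.
Qed.

(** Shifted by its norm, each [x] in [s] takes values between 0 and twice the norm, a range cut by
    finitely many bins of width [r]. The cell of [t] records the bin of [x t] for every [x] in the
    list. *)
Lemma linfty_finite_partition (s : seq (linfty R T)) (r : R) : 0 < r ->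
  exists (C : finType) (c : T -> C), forall t u, c t = c u ->
    forall x, x \in s -> `|x t - x u| <= r.
Proof.
move=> r0; elim: s => [|x s [C [c cs]]]; first by exists unit, (fun=> tt).
pose bin t := Num.truncn ((x t + `|x|) / r).
have xt0 t : 0 <= x t + `|x|.
  have := linfty_eval_norm x t; rewrite ler_norml => /andP[+ _].
  by rewrite -subr_ge0 opprK.
have bin_lt t : (bin t < (Num.truncn (`|x| *+ 2 / r)).+1)%N.
  rewrite ltnS /bin; apply: le_truncn.
  rewrite ler_pM2r ?invr_gt0// mulr2n lerD2r.
  by rewrite (le_trans (ler_norm _))// linfty_eval_norm.
exists (C * 'I_(Num.truncn (`|x| *+ 2 / r)).+1)%type.
exists (fun t => (c t, Ordinal (bin_lt t))) => t u [ctu btu] y.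
rewrite inE => /predU1P[->|]; last exact: cs.
have bnd v : (bin v)%:R * r <= x v + `|x| < (bin v).+1%:R * r.
  rewrite -ler_pdivlMr// -ltr_pdivrMr//.
  by apply: truncn_itv; rewrite divr_ge0// ltW.
move: (bnd t) (bnd u); rewrite btu -natr1 mulrDl mul1r => /andP[a1 a2] /andP[b1 b2].
rewrite ler_norml; apply/andP; split; lra.
Qed.

End linfty_space.

Lemma measurable_eval (R : realType) (T : Type) (t : T) :
  measurable_fun setT ((fun x : linfty R T => x t) : borel (linfty R T) -> R).
Proof.
by apply: (lipschitz_measurable (c := 1)) => x y; rewrite mul1r;
  exact: linfty_eval_lipschitz.
Qed.

(** * The rho_P-modulus as a functional on [linfty] *)

Section modulus.
Context {R : realType} {p : nat} (P : probability (borel 'rV[R]_p) R)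
  (F : set (borel 'rV[R]_p -> R)).
Implicit Types x y : linfty R F.

Let osc (delta : R) (x : linfty R F) := [set `|x fg.1 - x fg.2| |
  fg in [set fg : F * F | rho P (val fg.1) (val fg.2) < delta]].

Lemma modulus_ub (delta : R) x (f g : F) :
  rho P (val f) (val g) < delta -> `|x f - x g| <= modulus P delta x.
Proof.
move=> fg; apply: ub_le_sup; last by exists (f, g).
exists (`|x| *+ 2) => _ [[a b] _ <-] /=.
by rewrite (le_trans (ler_normB _ _))// mulr2n lerD// linfty_eval_norm.
Qed.

Lemma modulus_le (delta : R) x (c : R) : 0 <= c ->
  (forall f g : F, rho P (val f) (val g) < delta -> `|x f - x g| <= c) ->
  modulus P delta x <= c.
Proof.
move=> c0 xc; rewrite /modulus -/(osc delta x).
(* If no pair is closer than [delta], the supremum is 0 by default; this case is the reason for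
   assuming [0 <= c]. *)
have [->|/set0P ne] := eqVneq (osc delta x) set0; first by rewrite sup0.
by apply: ge_sup => // _ [[f g] /= fg <-]; exact: xc.
Qed.

Lemma modulus_ge0 (delta : R) x : 0 <= modulus P delta x.
Proof.
rewrite /modulus -/(osc delta x).
have [->|/set0P[_ [[f g] /= fg _]]] := eqVneq (osc delta x) set0.
  by rewrite sup0.
exact: le_trans (modulus_ub x fg).
Qed.

Lemma modulus_homo (delta delta' : R) x :
  delta <= delta' -> modulus P delta x <= modulus P delta' x.
Proof.
move=> dd; apply: modulus_le => [|f g fg]; first exact: modulus_ge0.
by apply: modulus_ub; exact: lt_le_trans dd.
Qed.

(** Both evaluations, at [f] and at [g], move by at most [|x - y|], whence the factor 2. Continuity
    then makes the modulus Borel although its supremum may run over an uncountable set. *)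
Lemma modulus_lipschitz (delta : R) x y :
  `|modulus P delta x - modulus P delta y| <= 2 * `|x - y|.
Proof.
suff le x' y' : modulus P delta x' <= modulus P delta y' + 2 * `|x' - y'|.
  have := le x y; have := le y x; rewrite (distrC y x) ler_norml.
  by move=> yx xy; apply/andP; split; lra.
apply: modulus_le => [|f g fg].
  by rewrite addr_ge0 ?modulus_ge0// mulr_ge0.
rewrite (_ : x' f - x' g = (y' f - y' g) + ((x' f - y' f) - (x' g - y' g)));
  last by ring.
rewrite (le_trans (ler_normD _ _))// lerD ?modulus_ub//.
by rewrite (le_trans (ler_normB _ _))// mulrDl !mul1r lerD// linfty_eval_lipschitz.
Qed.

Lemma measurable_modulus (delta : R) :
  measurable_fun setT (modulus P delta : borel (linfty R F) -> R).
Proof. exact: lipschitz_measurable (modulus_lipschitz delta). Qed.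

Lemma modulus_set_measurable d (T : measurableType d) (X : T -> linfty R F)
    (delta e : R) : measurable_fun setT (X : T -> borel (linfty R F)) ->
  measurable [set t | e < modulus P delta (X t)].
Proof.
move=> mX; apply: measurable_ltr => //.
exact: (measurableT_comp (measurable_modulus delta) mX).
Qed.

End modulus.

(** * Second-moment bounds from Chebyshev's inequality *)

Section moments.
Context {R : realType}.

Lemma integral_ge_on d (T : measurableType d) (mu : {measure set T -> \bar R})
    (f : T -> R) (c : R) (A : set T) :
  measurable A -> measurable_fun setT f -> (forall t, 0 <= f t) -> 0 <= c ->
  (forall t, A t -> c <= f t) -> (c%:E * mu A <= \int[mu]_t (f t)%:E)%E.
Proof.
move=> mA mf f0 c0 cf; rewrite -integral_cst//.
apply: (@le_trans _ _ (\int[mu]_(t in A) (f t)%:E)%E).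
  apply: ge0_le_integral => //=.
  - by apply/measurable_EFinP; exact: measurable_funTS.
apply: ge0_subset_integral => //; first exact/measurable_EFinP.
by move=> t _; rewrite lee_fin.
Qed.

(** Used for a Gaussian [Y] of mean [m] and standard deviation at most [2 * t] in absolute value: 24
    is 6 times 2 squared, with 6 from [normal_second_moment]. *)
Lemma second_moment_le d (T : measurableType d) (mu : probability T R)
    (Y : T -> R) (m t : R) : measurable_fun setT Y -> 0 < t ->
  (\int[mu]_x ((Y x - m) ^+ 2)%:E <= (24 * t ^+ 2)%:E)%E ->
  (2^-1%:E <= mu [set x | (`|Y x| <= t)%R])%E ->
  (\int[mu]_x (Y x ^+ 2)%:E <= (176 * t ^+ 2)%:E)%E.
Proof.
move=> mY t0 Ym Yt.
have mYm : measurable_fun setT (fun x => (Y x - m) ^+ 2).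
  by apply: measurable_funX; exact: measurable_funB.
(* If [|m| > t], then [|Y - m| >= |m| - t] on an event of probability at least 1/2, so half of
   [(|m| - t) ^+ 2] is at most [24 * t ^+ 2], and 1 plus the square root of 48 is below 8. *)
have m8 : `|m| <= 8 * t.
  have [|tm] := leP `|m| t; first by nra.
  have mA : measurable [set x | `|Y x| <= t].
    by apply: measurable_ler => //; exact: measurableT_comp.
  have := integral_ge_on mu mA mYm (c := (`|m| - t) ^+ 2).
  move=> /(_ (fun=> sqr_ge0 _) (sqr_ge0 _)) le1.
  have : (((`|m| - t) ^+ 2 * 2^-1)%:E <= (24 * t ^+ 2)%:E)%E.
    apply: le_trans Ym; apply: le_trans (le1 _).
      by rewrite EFinM lee_pmul2l// ?lte_fin ?fin_numE// exprn_gt0// subr_gt0.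
    move=> x /= Yxt; rewrite -[leRHS]real_normK ?num_real// distrC.
    rewrite lerXn2r ?nnegrE ?subr_ge0 ?(ltW tm)//.
    rewrite (le_trans _ (lerB_dist _ _))// lerD2l lerN2//.
  by rewrite lee_fin; nra.
(* The two terms contribute 2 * 24 and 2 * 64, which add up to 176. *)
apply: (@le_trans _ _ (\int[mu]_x (2 * (Y x - m) ^+ 2 + 2 * m ^+ 2)%:E)%E).
  apply: ge0_le_integral => //=.
  - by move=> x _; rewrite lee_fin sqr_ge0.
  - by apply/measurable_EFinP; exact: measurable_funX.
  - apply/measurable_EFinP; apply: measurable_funD => //; exact: measurable_funM.
  - by move=> x _; rewrite lee_fin; have := sqr_ge0 (Y x - 2 * m); nra.
under eq_integral do rewrite EFinD EFinM.
rewrite ge0_integralD//=; last 3 first.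
- by move=> x _; rewrite mule_ge0// lee_fin ?sqr_ge0.
- apply: emeasurable_funM => //; exact/measurable_EFinP.
- by move=> x _; rewrite lee_fin mulr_ge0// sqr_ge0.
rewrite ge0_integralZl//=; last 2 first.
- exact/measurable_EFinP.
- by move=> x _; rewrite lee_fin sqr_ge0.
rewrite integral_cst//= probability_setT mule1.
apply: (@le_trans _ _ (2%:E * (24 * t ^+ 2)%:E + (2 * m ^+ 2)%:E)%E).
  by rewrite leeD2r// lee_pmul2l// fin_numE.
rewrite -EFinM -EFinD lee_fin.
have : m ^+ 2 <= (8 * t) ^+ 2.
  by rewrite -real_normK ?num_real// lerXn2r ?nnegrE// mulr_ge0// ltW.
by rewrite expr2; nra.
Qed.

End moments.

(** * Moments and anti-concentration of normal laws *)

Section normal.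
Context {R : realType}.
Variables (m s : R).
Hypothesis s0 : s != 0.
Local Notation mu := (@lebesgue_measure R).

(** The Radon-Nikodym derivative of [normal_prob] and [normal_pdf] have the same integral over every
    measurable set, hence agree almost everywhere. *)
Lemma ge0_integral_normal_prob (f : R -> \bar R) :
  (forall x, 0 <= f x)%E -> measurable_fun setT f ->
  (\int[normal_prob m s]_x f x = \int[mu]_x (f x * (normal_pdf m s x)%:E))%E.
Proof.
move=> f0 mf; have dom := normal_prob_dominates m s.
rewrite -(Radon_Nikodym_SigmaFinite.change_of_variables dom f0)//.
apply: ge0_ae_eq_integral => //.
- apply: emeasurable_funM => //.
  exact: (measurable_int _ (Radon_Nikodym_SigmaFinite.f_integrable dom)).
- apply: emeasurable_funM => //; apply/measurable_EFinP.
  exact: measurable_normal_pdf.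
- by move=> x _; rewrite mule_ge0// Radon_Nikodym_SigmaFinite.f_ge0.
- by move=> x _; rewrite mule_ge0// lee_fin normal_pdf_ge0.
- apply: ae_eqe_mul2l; apply: integral_ae_eq => //.
  + exact: Radon_Nikodym_SigmaFinite.f_integrable.
  + by apply/measurable_EFinP; exact: measurable_normal_pdf.
  + by move=> E _ mE; rewrite -Radon_Nikodym_SigmaFinite.f_integral.
Qed.

Lemma normal_peak_double : normal_peak s = 2 * normal_peak (2 * s).
Proof.
rewrite /normal_peak.
have -> : (2 * s) ^+ 2 * pi *+ 2 = 2 ^+ 2 * (s ^+ 2 * pi *+ 2) by ring.
by rewrite (sqrtrM _ (sqr_ge0 _)) sqrtr_sqr ger0_norm// invfM mulVKf.
Qed.

(* Doubling the standard deviation absorbs the quadratic factor, so the second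
   moment is bounded without integrating by parts. *)
Lemma sqr_normal_pdf_le (x : R) :
  (x - m) ^+ 2 * normal_pdf m s x <= 6 * s ^+ 2 * normal_pdf m (2 * s) x.
Proof.
have s20 : 2 * s != 0 by rewrite mulf_neq0.
rewrite !normal_pdfE// normal_peak_double.
have := normal_peak_ge0 (2 * s); move: (normal_peak _) => k k0.
rewrite /normal_fun exprMn.
have b0 : 0 < s ^+ 2 by rewrite exprn_even_gt0.
have := sqr_ge0 (x - m); move: ((x - m) ^+ 2) (s ^+ 2) b0 => a b b0 a0.
(* [v] is the gap between the exponents for deviations [s] and [2 * s]. Since [a = 8 * b * v / 3]
   and [expR v >= 1 + v], the product [a * expR (- v)] is at most [3 * b]; the doubled peak turns 3
   into 6. *)
pose v := 3 * a / (8 * b).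
have v0 : 0 <= v by rewrite divr_ge0// mulr_ge0// ltW.
have -> : - a / (b *+ 2) = - a / (2 ^+ 2 * b *+ 2) + - v.
  by rewrite /v; field; rewrite gt_eqF.
rewrite expRD; have := expR_ge0 (- a / (2 ^+ 2 * b *+ 2)).
move: (expR (- a / _)) => E E0.
have av : a * expR (- v) <= 3 * b.
  rewrite expRN ler_pdivrMr ?expR_gt0//.
  have := expR_ge1Dx v; have -> : a = 8 * b * v / 3.
    by rewrite /v; field; rewrite gt_eqF.
  by move: (expR v) => ev; nra.
have := ler_wpM2l (mulr_ge0 k0 E0) av; nra.
Qed.

Lemma normal_second_moment :
  (\int[normal_prob m s]_x ((x - m) ^+ 2)%:E <= (6 * s ^+ 2)%:E)%E.
Proof.
have mx : measurable_fun setT (fun x : R => (x - m) ^+ 2).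
  by apply: measurable_funX; exact: measurable_funB.
rewrite ge0_integral_normal_prob//; last 2 first.
- by move=> x; rewrite lee_fin sqr_ge0.
- exact/measurable_EFinP.
apply: (@le_trans _ _
    (\int[mu]_x ((6 * s ^+ 2)%:E * (normal_pdf m (2 * s) x)%:E))%E).
  apply: ge0_le_integral => //=.
  - by move=> x _; rewrite -EFinM lee_fin mulr_ge0 ?sqr_ge0 ?normal_pdf_ge0.
  - apply: emeasurable_funM; first exact/measurable_EFinP.
    by apply/measurable_EFinP; exact: measurable_normal_pdf.
  - apply: emeasurable_funM => //.
    by apply/measurable_EFinP; exact: measurable_normal_pdf.
  - by move=> x _; rewrite -!EFinM lee_fin sqr_normal_pdf_le.
rewrite ge0_integralZl//=.
- by rewrite integral_normal_pdf mule1.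
- by apply/measurable_EFinP; exact: measurable_normal_pdf.
- by move=> x _; rewrite lee_fin normal_pdf_ge0.
- by rewrite lee_fin mulr_ge0// sqr_ge0.
Qed.

Lemma normal_anticoncentration (t : R) : 0 <= t ->
  (normal_prob m s `[(- t)%R, t] <= (t / `|s|)%:E)%E.
Proof.
move=> t0; rewrite /normal_prob.
apply: (@le_trans _ _ (\int[mu]_(x in `[(- t)%R, t]) (normal_peak s)%:E)%E).
  apply: ge0_le_integral => //=.
  - by move=> x _; rewrite lee_fin normal_pdf_ge0.
  - by apply/measurable_EFinP/measurable_funTS; exact: measurable_normal_pdf.
  - by move=> x _; rewrite lee_fin normal_pdf_ub.
rewrite integral_cst//= lebesgue_measure_itv/= lte_fin.
have s_gt0 : 0 < `|s| by rewrite normr_gt0.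
case: ifPn => _; last by rewrite mule0 lee_fin divr_ge0.
rewrite -EFinB -EFinM lee_fin opprK.
have peak : normal_peak s <= (`|s| * 2)^-1.
  rewrite /normal_peak lef_pV2 ?posrE ?mulr_gt0//; last first.
    by rewrite sqrtr_gt0 pmulrn_lgt0// mulr_gt0 ?pi_gt0// exprn_even_gt0.
  rewrite -mulrnAr sqrtrM ?sqr_ge0// sqrtr_sqr ler_pM2l//.
  rewrite -[leLHS]ger0_norm// -sqrtr_sqr ler_wsqrtr//.
  have := pi_ge2 R; lra.
rewrite (le_trans (ler_wpM2r _ peak))//; first by rewrite addr_ge0.
rewrite le_eqVlt; apply/orP; left; apply/eqP; field.
by rewrite gt_eqF.
Qed.

End normal.

(* Anti-concentration gives |s| <= 2 t for the standard deviation s of Y. *)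
Lemma gaussian_second_moment (R : realType) d (T : measurableType d)
    (PT : probability T R) (Y : T -> R) (t : R) :
  gaussian PT Y -> 0 < t -> (2^-1%:E <= PT [set x | (`|Y x| <= t)%R])%E ->
  (\int[PT]_x (Y x ^+ 2)%:E <= (176 * t ^+ 2)%:E)%E.
Proof.
move=> [mY [m [s Yms]]] t0 Yt; apply: (@second_moment_le _ _ _ _ _ m) => //.
(* [normal_prob] is a measure on [measurableTypeR R], which has the same
   measurable sets as R but another display. *)
pose f (y : measurableTypeR R) := (((y : R) - m) ^+ 2)%:E.
pose Y' : T -> measurableTypeR R := Y.
have mY' : measurable_fun setT Y' by exact: mY.
have mf : measurable_fun setT f.
  by apply/measurable_EFinP/measurable_funX; exact: measurable_funB.
have f0 y : (0 <= f y)%E by rewrite lee_fin sqr_ge0.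
rewrite (_ : \int[PT]_x _ = \int[pushforward PT Y']_y f y)%E; last first.
  by rewrite ge0_integral_pushforward.
(* In the degenerate case the law is the point mass at [m], so the centred second moment is 0. *)
have [s0|s0] := eqVneq s 0.
  rewrite (_ : \int[_]_y f y = \int[\d_(m : measurableTypeR R)]_y f y)%E; last first.
    apply: eq_measure_integral.
    by move=> A mA _; have := Yms A mA; rewrite s0 eqxx; exact.
  by rewrite integral_dirac// diracT mul1e lee_fin subrr expr0n/= mulr_ge0// sqr_ge0.
rewrite (_ : \int[_]_y f y = \int[normal_prob m s]_y f y)%E; last first.
  apply: eq_measure_integral.
  by move=> A mA _; have := Yms A mA; rewrite (negbTE s0); exact.
apply: (le_trans (normal_second_moment m s0)); rewrite lee_fin.
have : (2^-1%:E <= (t / `|s|)%:E)%E.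
  apply: le_trans (normal_anticoncentration m s0 (ltW t0)).
  have := Yms `[- t, t]%classic (measurable_itv _); rewrite (negbTE s0) => <-.
  by rewrite (_ : Y @^-1` _ = [set x | `|Y x| <= t])//; apply/seteqP; split => x /=;
    rewrite in_itv/= ler_norml.
have s_gt0 : 0 < `|s| by rewrite normr_gt0.
rewrite lee_fin ler_pdivlMr// => st.
by rewrite -[s ^+ 2]real_normK ?num_real//; nra.
Qed.

(** * Square-integrable functions *)

Section square_integrable.
Context {R : realType} d (T : measurableType d) (mu : probability T R).
Implicit Types f g : T -> R.

Lemma Rintegral_sqrB f g :
  mu.-integrable setT (fun t => (f t * f t)%:E) ->
  mu.-integrable setT (fun t => (f t * g t)%:E) ->
  mu.-integrable setT (fun t => (g t * g t)%:E) ->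
  mu.-integrable setT (fun t => ((f t - g t) ^+ 2)%:E) /\
  \int[mu]_t ((f t - g t) ^+ 2) =
  \int[mu]_t (f t * f t) - 2 * \int[mu]_t (f t * g t) + \int[mu]_t (g t * g t).
Proof.
move=> ff fg gg.
have fg2 : mu.-integrable setT (fun t => (2 * (f t * g t))%:E).
  by under eq_fun do rewrite EFinM; exact: integrableZl.
have E t : (f t - g t) ^+ 2 = f t * f t - 2 * (f t * g t) + g t * g t by ring.
split.
  under eq_fun do rewrite E EFinD EFinB.
  by apply: integrableD => //; exact: integrableB.
under eq_Rintegral do rewrite E.
rewrite RintegralD//.
  by rewrite RintegralB// RintegralZl.
exact: (integrableB measurableT ff fg2).
Qed.

Lemma integrable_mul_sqr f g :
  measurable_fun setT f -> measurable_fun setT g ->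
  mu.-integrable setT (fun t => (f t * f t)%:E) ->
  mu.-integrable setT (fun t => (g t * g t)%:E) ->
  mu.-integrable setT (fun t => (f t * g t)%:E).
Proof.
move=> mf mg ff gg.
apply: (@le_integrable _ _ _ mu _ _ _
    (fun t => (f t * f t)%:E + (g t * g t)%:E)%E) => //.
- by apply/measurable_EFinP; exact: measurable_funM.
- move=> t _; rewrite -EFinD !abse_EFin lee_fin.
  rewrite [leRHS]ger0_norm; last by rewrite addr_ge0// -expr2 sqr_ge0.
  rewrite ler_norml; apply/andP; split.
    by have := sqr_ge0 (f t + g t); have := sqr_ge0 (f t); have := sqr_ge0 (g t); nra.
  by have := sqr_ge0 (f t - g t); have := sqr_ge0 (f t); have := sqr_ge0 (g t); nra.
- exact: integrableD.
Qed.

End square_integrable.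

(** * Finite nets and representatives of cells *)

Lemma compact_finite_net (R : realType) (V : normedModType R) (K : set V) (r : R) :
  compact K -> 0 < r ->
  exists s : seq V, forall x, K x -> exists2 y, y \in s & `|x - y| < r.
Proof.
rewrite compact_cover => cK r0.
have [|x Kx|D _ KD] := cK V K (fun y => ball y r).
- by move=> y _; exact: ball_open.
- by exists x => //; exact: ballxx.
- exists (finmap.enum_fset D) => x /KD[y /= yD]; rewrite -ball_normE/= => yx.
  by exists y => //; rewrite distrC.
Qed.

(** One representative is chosen per cell, with an arbitrary [t0] for cells that are not attained.
    An empty [T] has no such point and takes [k = 0]. *)
Lemma finite_partition_net (T : Type) (C : finType) (c : T -> C) :
  exists k (f : 'I_k -> T) (pi : T -> 'I_k), forall t, c (f (pi t)) = c t.
Proof.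
have [[t0 _]|noT] := pselect (exists t : T, True); last first.
  have f : 'I_0 -> T by case.
  have g : T -> 'I_0 by move=> t; case: noT; exists t.
  by exists 0%N, f, g => t; case: noT; exists t.
pose rep (b : C) :=
  if pselect (exists t, c t = b) is left h then projT1 (cid h) else t0.
exists #|C|, (fun i => rep (enum_val i)), (fun t => enum_rank (c t)) => t.
rewrite enum_rankK /rep; case: pselect => [h|]; first by case: cid.
by case; exists t.
Qed.

(** * Consequences of tightness for the Brownian bridge *)

Section tight_bridge.
Context {R : realType} {p : nat} (P : probability (borel 'rV[R]_p) R)
  (F : set (borel 'rV[R]_p -> R))
  (F_L2 : forall f, F f -> f \in Lfun P 2%:E)
  d (T : measurableType d) (PT : probability T R) (X : T -> linfty R F)
  (mX : measurable_fun setT (X : T -> borel (linfty R F)))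
  (X_tight : tight_rv PT X)
  (X_bridge : brownian_bridge P PT X).

Let mXe (f : F) : measurable_fun setT (fun t => X t f).
Proof. exact: (measurableT_comp (measurable_eval f) mX). Qed.

(** Expanding both squares, the covariance formula identifies the left side with the variance of
    [f - g] under [P], which is the square of [rho]. *)
Lemma bridge_increment (f g : F) :
  (\int[PT]_t ((X t f - X t g) ^+ 2)%:E = (rho P (val f) (val g) ^+ 2)%:E)%E.
Proof.
have [_ _ cov] := X_bridge.
(* The covariance formula at equal arguments has a real right-hand side, so the second moment is
   finite. *)
have iXX (h : F) : PT.-integrable setT (fun t => (X t h * X t h)%:E).
  apply/integrableP; split; first by apply/measurable_EFinP; exact: measurable_funM.
  under eq_integral do rewrite gee0_abs ?lee_fin -?expr2 ?sqr_ge0//.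
  have := cov h h; rewrite unlock => E.
  by rewrite (_ : \int[PT]_x _ = \int[PT]_x (X x h * X x h)%:E)%E// E ltry.
have covR (h k : F) : \int[PT]_t (X t h * X t k) =
    \int[P]_x (val h x * val k x) - (\int[P]_x val h x) * (\int[P]_x val k x).
  by have := cov h k; rewrite unlock => E; rewrite /Rintegral E.
have [isq esq] := Rintegral_sqrB (iXX f)
  (integrable_mul_sqr (mXe f) (mXe g) (iXX f) (iXX g)) (iXX g).
have PL (h : F) : val h \in Lfun P 2%:E by apply: F_L2; exact: set_mem (valP h).
have iP2 (h k : F) : P.-integrable setT (fun x => (val h x * val k x)%:E).
  by have /Lfun1_integrable := Lfun2_mul_Lfun1 (PL h) (PL k).
have iP (h : F) : P.-integrable setT (fun x => (val h x)%:E).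
  by apply/Lfun1_integrable; apply: Lfun_subset12 (PL h); exact: fin_num_measure.
have [isqP esqP] := Rintegral_sqrB (iP2 f f) (iP2 f g) (iP2 g g).
pose m := \int[P]_x (val f x - val g x).
pose D x := val f x - val g x.
have iD : P.-integrable setT (fun x => (D x)%:E).
  by under eq_fun do rewrite /D EFinB; exact: integrableB.
have iDD : P.-integrable setT (fun x => (D x * D x)%:E).
  by under eq_fun do rewrite -expr2.
have iDm : P.-integrable setT (fun x => (D x * m)%:E).
  by under eq_fun do rewrite EFinM; exact: integrableZr.
have imm : P.-integrable setT (fun x : borel 'rV[R]_p => (m * m)%:E).
  exact: (finite_measure_integrable_cst P (m * m)).
have [_ erho] := Rintegral_sqrB iDD iDm imm.
have -> : (\int[PT]_t ((X t f - X t g) ^+ 2)%:E =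
    (\int[PT]_t ((X t f - X t g) ^+ 2))%:E)%E.
  by rewrite /Rintegral fineK//; exact: integrable_fin_num.
congr EFin; rewrite /rho sqr_sqrtr; last by apply: Rintegral_ge0 => x _; exact: sqr_ge0.
rewrite -/m erho esq !covR RintegralZr// Rintegral_cst//= probability_setT mulr1.
have -> : \int[P]_x (D x * D x) = \int[P]_x ((val f x - val g x) ^+ 2).
  by apply: eq_Rintegral => x _; rewrite expr2.
rewrite esqP -/m.
have -> : m = \int[P]_x val f x - \int[P]_x val g x
  by exact: (RintegralB measurableT (iP f) (iP g)).
ring.
Qed.

Lemma bridge_increment_gaussian (f g : F) : gaussian PT (fun t => X t f - X t g).
Proof.
have [gp _ _] := X_bridge.
have := gp 2%N (fun i => if i == ord0 then 1 else -1)
  (fun i => if i == ord0 then f else g).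
congr gaussian; apply/funext => t.
by rewrite !big_ord_recl big_ord0/= mul1r mulN1r addr0.
Qed.

Let ball_measurable (y : linfty R F) (r : R) :
  measurable [set t | `|X t - y| < r].
Proof.
have mdist : measurable_fun setT ((fun x => `|x - y|) : borel (linfty R F) -> R).
  apply: (lipschitz_measurable (c := 1)) => x z.
  by rewrite mul1r (le_trans (ler_dist_dist _ _))// opprB addrA subrK.
by apply: measurable_ltr => //; exact: (measurableT_comp mdist mX).
Qed.

Lemma modulus_ball (y : linfty R F) (r : R) : 0 < r ->
  (0 < PT [set t | (`|X t - y| < r)%R])%E ->
  exists2 delta, 0 < delta & modulus P delta y <= 3 * r.
Proof.
move=> r0; set B := [set t | _]; move=> PB0.
have PBfin : PT B \is a fin_num by exact: fin_num_measure (ball_measurable y r).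
pose c := fine (PT B).
have c0 : 0 < c by rewrite fine_gt0// PB0 ltey_eq PBfin.
have c1 : c <= 1.
  by rewrite -lee_fin fineK// probability_le1//; exact: ball_measurable.
(* If [y] moved by more than [3 * r], every path in the ball would move by at least [r], so
   [r ^+ 2 * c <= rho ^+ 2 < (r * c) ^+ 2]. This contradicts [c <= 1]. *)
exists (r * c); first exact: mulr_gt0.
apply: modulus_le => [|f g fg]; first by rewrite mulr_ge0// ltW.
rewrite leNgt; apply/negP => yfg.
have mI : measurable_fun setT (fun t => (X t f - X t g) ^+ 2).
  by apply: measurable_funX; exact: measurable_funB.
have far t : B t -> r ^+ 2 <= (X t f - X t g) ^+ 2.
  move=> /= Xty.
  have hf := le_lt_trans (linfty_eval_lipschitz (X t) y f) Xty.
  have hg := le_lt_trans (linfty_eval_lipschitz (X t) y g) Xty.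
  rewrite -[leRHS]real_normK ?num_real// lerXn2r ?nnegrE//; first exact: ltW.
  have : `|y f - y g| <= `|X t f - X t g| + `|X t f - y f| + `|X t g - y g|.
    rewrite (_ : y f - y g = (X t f - X t g) - (X t f - y f) + (X t g - y g)).
      by rewrite (le_trans (ler_normD _ _))// lerD2r ler_normB.
    by ring.
  by lra.
have := integral_ge_on PT (ball_measurable y r) mI (fun=> sqr_ge0 _) (sqr_ge0 r) far.
have Bc : PT B = c%:E by rewrite fineK.
rewrite bridge_increment /= Bc -EFinM lee_fin.
have rho0 : 0 <= rho P (val f) (val g) by exact: sqrtr_ge0.
apply/negP; rewrite -ltNge.
apply: (@lt_le_trans _ _ ((r * c) ^+ 2)).
  by rewrite ltrXn2r// nnegrE// mulr_ge0// ltW.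
by rewrite exprMn ler_wpM2l ?sqr_ge0// expr2 ler_piMl// ltW.
Qed.

(** By induction on the net: a ball of probability zero is absorbed into [N], and any other ball
    lowers [delta] through [modulus_ball]. *)
Lemma modulus_net (s : seq (linfty R F)) (r : R) : 0 < r ->
  exists delta (N : set T), [/\ 0 < delta, measurable N, PT N = 0%E &
    forall t y, ~ N t -> y \in s -> `|X t - y| < r -> modulus P delta y <= 3 * r].
Proof.
move=> r0; elim: s => [|y s [delta [N [d0 mN N0 sN]]]].
  by exists 1, set0; split.
have [PB0|PB0] := eqVneq (PT [set t | (`|X t - y| < r)%R]) 0%E.
  exists delta, (N `|` [set t | `|X t - y| < r]); split => //.
  - by apply: measurableU.
  - by rewrite measureU0.
  - move=> t z /not_orP[Nt Bt]; rewrite inE => /predU1P[->//|zs].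
    exact: sN zs.
have [|e e0 ye] := @modulus_ball y r r0; first by rewrite lt0e PB0/=.
exists (Num.min delta e), N; split => //; first by rewrite lt_min d0.
move=> t z Nt; rewrite inE => /predU1P[->|zs] Xtz.
  by apply: le_trans ye; apply: modulus_homo; rewrite ge_min lexx orbT.
apply: le_trans (sN t z Nt zs Xtz); apply: modulus_homo.
by rewrite ge_min lexx.
Qed.

Lemma compact_preimage_measurable (K : set (linfty R F)) :
  compact K -> measurable (X @^-1` K).
Proof.
move=> cK; rewrite -[X in measurable X]setTI; apply: mX => //.
rewrite -[X in measurable X]setCK; apply: measurableC.
apply: sub_sigma_algebra; apply: closed_openC.
by apply: compact_closed => //; exact: norm_hausdorff.
Qed.

Lemma tight_modulus (e eta : R) : 0 < e -> 0 < eta ->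
  exists2 delta, 0 < delta &
    (PT [set t | (e < modulus P delta (X t))%R] <= eta%:E)%E.
Proof.
move=> e0 eta0; have [K cK PK] := X_tight eta0.
have mK := compact_preimage_measurable cK.
(* With radius [r = e / 5], the net point has modulus at most [3 * r], and passing from it to the
   path costs at most [2 * r]. *)
have r0 : 0 < e / 5 by rewrite divr_gt0.
have [s sK] := compact_finite_net cK r0.
have [delta [N [d0 mN N0 sN]]] := modulus_net s r0.
exists delta => //.
apply: (@le_trans _ _ (PT (~` (X @^-1` K) `|` N))).
  apply: le_measure; rewrite ?inE.
  - exact: modulus_set_measurable.
  - by apply: measurableU => //; exact: measurableC.
  move=> t /= et; apply: contrapT => /not_orP[/contrapT Kt Nt].
  have [y ys Xty] := sK _ Kt.
  have := sN _ _ Nt ys Xty; have := modulus_lipschitz P delta (X t) y.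
  by rewrite ler_norml => /andP[_]; lra.
rewrite measureU0//=; last exact: measurableC.
rewrite probability_setC// leeBlDr ?fin_num_measure//.
by rewrite -leeBlDl// -EFinB.
Qed.

Lemma bridge_totally_bounded (delta : R) : 0 < delta ->
  exists k (f : 'I_k -> F) (pi : F -> 'I_k),
    forall g, rho P (val g) (val (f (pi g))) < delta.
Proof.
move=> d0; have half0 : 0 < 2^-1 :> R by rewrite invr_gt0.
have [K cK PK] := X_tight half0.
have mK := compact_preimage_measurable cK.
(* On [K] the increment is at most [3 * r]: one [r] for each passage to the net point and one for
   the cell. Its second moment is then at most 176 * 9 = 1584 times [r ^+ 2], below 41 squared,
   1681. *)
pose r := delta / 41.
have r0 : 0 < r by rewrite divr_gt0.
have [s sK] := compact_finite_net cK r0.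
have [C [c cs]] := linfty_finite_partition s r0.
have [k [f [pi fpi]]] := finite_partition_net c.
exists k, f, pi => g.
have close t : K (X t) -> `|X t g - X t (f (pi g))| <= 3 * r.
  move=> /sK[y ys Xty].
  have hg := le_lt_trans (linfty_eval_lipschitz (X t) y g) Xty.
  have hf := le_lt_trans (linfty_eval_lipschitz (X t) y (f (pi g))) Xty.
  have hy := cs g (f (pi g)) (esym (fpi g)) y ys.
  rewrite (_ : X t g - _ = (X t g - y g) + (y g - y (f (pi g))) -
    (X t (f (pi g)) - y (f (pi g)))); last by ring.
  rewrite (le_trans (ler_normB _ _))//.
  have := ler_normD (X t g - y g) (y g - y (f (pi g))); lra.
have r30 : 0 < 3 * r by rewrite mulr_gt0.
have half : (2^-1%:E <= PT [set t | (`|X t g - X t (f (pi g))| <= 3 * r)%R])%E.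
  apply: (@le_trans _ _ (PT (X @^-1` K))).
    by apply: le_trans PK; rewrite lee_fin; lra.
  apply: le_measure; rewrite ?inE//.
  apply: measurable_ler => //.
  by apply: measurableT_comp => //; exact: measurable_funB.
have := gaussian_second_moment (bridge_increment_gaussian g (f (pi g))) r30.
rewrite bridge_increment lee_fin => /(_ half).
have : 0 <= rho P (val g) (val (f (pi g))) by exact: sqrtr_ge0.
move: (rho _ _ _) => q q0 qr.
by rewrite ltNge; apply/negP => dq; move: qr; rewrite /r; nra.
Qed.

End tight_bridge.

(** * Upper limits and convergence to zero *)

Section limn_esup0.
Context {R : realType}.
Implicit Types u : (\bar R)^nat.

Lemma limn_esup_lt_near u (x : \bar R) :
  (limn_esup u < x)%E -> \forall n \near \oo, (u n < x)%E.
Proof.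
move=> /ereal_inf_lt[_ [V V_oo <-] Vx]; apply: filterS V_oo => n Vn.
by apply: le_lt_trans Vx; apply: ereal_sup_ubound; exists n.
Qed.

Lemma near_le_cvg0 u : (forall n, 0 <= u n)%E ->
  (forall e : R, 0 < e -> \forall n \near \oo, (u n <= e%:E)%E) ->
  u @ \oo --> 0%E.
Proof.
move=> u0 ue; apply: limn_esup_le_cvg => //; apply/lee_addgt0Pr => e e0.
rewrite add0e; pose V := [set n | (u n <= e%:E)%E].
apply: (@le_trans _ _ (ereal_sup [set u n | n in V])).
  by apply: ereal_inf_lbound; exists V => //; exact: ue.
by apply: ge_ereal_sup => _ [n /= une <-].
Qed.

Lemma cvg0_near_lt T (G : set_system T) (f : T -> \bar R) (e : R) :
  f x @[x --> G] --> 0%E -> 0 < e -> \forall x \near G, (f x < e%:E)%E.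
Proof.
move=> f0 e0; apply: (f0 [set y | (y < e%:E)%E]).
by apply: open_ereal_lt'; rewrite lte_fin.
Qed.

End limn_esup0.

(** * Comparing the two processes through moduli and marginals *)

Section approximation.
Context {R : realType} {p : nat} (P : probability (borel 'rV[R]_p) R)
  (F : set (borel 'rV[R]_p -> R))
  dS (S : measurableType dS) (PS : probability S R) (Y : S -> linfty R F)
  (mY : measurable_fun setT (Y : S -> borel (linfty R F)))
  dT (T : measurableType dT) (PT : probability T R) (X : T -> linfty R F)
  (mX : measurable_fun setT (X : T -> borel (linfty R F))).

Lemma marginal_measurable d' (T' : measurableType d') (Z : T' -> linfty R F)
    k (f : 'I_k -> F) : measurable_fun setT (Z : T' -> borel (linfty R F)) ->
  measurable_fun setT ((fun t => marginal f (Z t)) : T' -> borel 'rV[R]_k).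
Proof.
move=> mZ; apply: (measurableT_comp _ mZ).
apply: (lipschitz_borel_measurable (c := 1)) => x y.
by rewrite mul1r marginal_lipschitz.
Qed.

Lemma BL_dist_marginal_le k (f : 'I_k -> F) :
  BL_dist PS (fun s => marginal f (Y s)) PT (fun t => marginal f (X t)) <=
  BL_dist PS Y PT X.
Proof. by apply: BL_dist_comp => // x y; exact: marginal_lipschitz. Qed.

Lemma modulus_prob_le (delta e : R) : 0 < e ->
  Num.min 1 (e / 4) * fine (PS [set s | (e < modulus P delta (Y s))%R]) <=
  Num.min 1 (e / 4) * fine (PT [set t | (e / 2 < modulus P delta (X t))%R])
  + BL_dist PS Y PT X.
Proof.
(* Half the modulus is 1-Lipschitz and climbs by [e / 4] as the modulus goes from [e / 2] to [e];
   the minimum with 1 keeps the test function bounded by 1. *)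
move=> e0; set c := Num.min _ _.
have c0 : 0 < c by rewrite lt_min ltr01 divr_gt0.
have c1 : c <= 1 by rewrite ge_min lexx.
have ce : c <= e / 4 by rewrite ge_min lexx orbT.
clearbody c.
(* h is c where the modulus exceeds e and 0 where it is at most e / 2. *)
pose h (x : linfty R F) := Num.min c (Num.max 0 ((modulus P delta x - e / 2) / 2)).
have h0 x : 0 <= h x by rewrite le_min (ltW c0) le_max lexx.
have hc x : h x <= c by rewrite ge_min lexx.
have h1 x : `|h x| <= 1 by rewrite ger0_norm// (le_trans (hc x)).
have hBL : BL1 (@norm_dist R (linfty R F)) h.
  have hle x y : h x <= h y + `|x - y|.
    have /ler_normlP[_ xy] := modulus_lipschitz P delta x y.
    rewrite /h addr_minl addr_maxl le_min !ge_min lerDl normr_ge0/=.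
    apply/orP; right; rewrite ge_max !le_max add0r normr_ge0/=.
    by apply/orP; right; lra.
  split=> // x y; rewrite /norm_dist ler_norml.
  by have := hle x y; have := hle y x; rewrite (distrC y x) => ? ?; apply/andP; split; lra.
have hY := BL1_comp_measurable hBL mY.
have hX := BL1_comp_measurable hBL mX.
have le1 : c * fine (PS [set s | e < modulus P delta (Y s)]) <= \int[PS]_s h (Y s).
  apply: (Rintegral_ge_on PS (M := 1)) => //; first exact: modulus_set_measurable.
  by move=> s /= es; rewrite /h le_min lexx le_max; apply/orP; right; lra.
have le2 : \int[PT]_t h (X t) <= c * fine (PT [set t | e / 2 < modulus P delta (X t)]).
  apply: (Rintegral_le_on PT (M := 1)) => //; first exact: modulus_set_measurable.
  move=> t /= /negP; rewrite -leNgt => te.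
  by rewrite /h ge_min; apply/orP; right; rewrite ge_max lexx/=; lra.
have := BL_dist_ge PS PT mY mX hBL; rewrite ler_norml => /andP[_].
lra.
Qed.

(** Triangle inequality through the projections of both processes onto step functions. The projected
    laws are compared by a test function on vectors; each projection moves a path by at most its
    modulus, which exceeds [e] only on the event charged with the factor 2. *)
Lemma BL_dist_approx (delta e : R) k (f : 'I_k -> F) (pi : F -> 'I_k) :
  0 <= e -> (forall g, rho P (val g) (val (f (pi g))) < delta) ->
  BL_dist PS Y PT X <=
  BL_dist PS (fun s => marginal f (Y s)) PT (fun t => marginal f (X t))
  + (e + 2 * fine (PS [set s | (e < modulus P delta (Y s))%R]))
  + (e + 2 * fine (PT [set t | (e < modulus P delta (X t))%R])).
Proof.
move=> e0 net; apply: BL_dist_le => // h hBL.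
pose A (x : linfty R F) : linfty R F := step pi (marginal f x).
have stepBL : BL1 (@norm_dist R 'rV[R]_k) (h \o step pi).
  split=> [v|v w]; first exact: hBL.1.
  exact: le_trans (hBL.2 _ _) (step_lipschitz pi v w).
have AX x : `|x - A x| <= modulus P delta x.
  apply: linfty_dist_le => [|g]; first exact: modulus_ge0.
  by rewrite /= mxE; exact: modulus_ub.
have dist d' (T' : measurableType d') (Q : probability T' R) (Z : T' -> linfty R F) :
    measurable_fun setT (Z : T' -> borel (linfty R F)) ->
    `|\int[Q]_t h (Z t) - \int[Q]_t h (A (Z t))| <=
    e + 2 * fine (Q [set t | (e < modulus P delta (Z t))%R]).
  move=> mZ; apply: (@Rintegral_dist_le _ _ _ _ _ _ 1) => //.
  - exact: modulus_set_measurable.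
  - exact: BL1_comp_measurable.
  - exact: (BL1_comp_measurable stepBL (marginal_measurable f mZ)).
  - by move=> t; exact: hBL.1.
  - by move=> t; exact: hBL.1.
  - move=> t /= /negP; rewrite -leNgt => te.
    by rewrite (le_trans (hBL.2 _ _))// (le_trans (AX _)).
have dY := dist _ _ PS Y mY; have dX := dist _ _ PT X mX.
have dm := BL_dist_ge PS PT
  (marginal_measurable f mY) (marginal_measurable f mX) stepBL.
move: dY dX dm; rewrite /= -/(A _).
move: (BL_dist _ _ _ _) => B.
rewrite !ler_norml => /andP[? ?] /andP[? ?] /andP[? ?].
by apply/andP; split; lra.
Qed.

End approximation.

(** * Both directions of the equivalence, conditionally on the training data *)

Theorem theorem2p1
  (R : realType) (p : nat) (P : probability (borel 'rV[R]_p) R)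
  (dU : measure_display) (U : measurableType dU) (PU : probability U R)
  (dO : nat -> measure_display) (Omega : forall n, measurableType (dO n))
  (PO : forall n, probability (Omega n) R)
  (Z : forall n, 'I_n -> Omega n -> borel 'rV[R]_p)
  (Z_iid : forall n, iid (PO n) P (Z n))
  (Ghat : forall n, Omega n * U -> borel 'rV[R]_p)
  (Ghat_measurable : forall n, measurable_fun setT (Ghat n))
  (dX : nat -> measure_display) (Xi : forall n, measurableType (dX n))
  (PX : forall n, probability (Xi n) R)
  (Ut : forall n, 'I_n -> Xi n -> U)
  (Ut_iid : forall n, iid (PX n) PU (Ut n))
  (F : set (borel 'rV[R]_p -> R))
  (F_L2 : forall f, F f -> f \in Lfun P 2%:E)
  (F_integrable : forall n (w : Omega n) f, F f ->
     (generated_law PU (fun u => Ghat n (w, u))).-integrable setT (EFin \o f))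
  (Gt : forall n, Omega n * Xi n -> linfty R F)
  (Gt_process : forall n (w : Omega n) (xi : Xi n) (f : F),
     Gt n (w, xi) f =
     bootstrap_process PU (fun u => Ghat n (w, u)) (fun i => Ut n i xi) (val f))
  (Gt_measurable : forall n,
     measurable_fun setT (Gt n : Omega n * Xi n -> borel (linfty R F)))
  (dT : measure_display) (Theta : measurableType dT) (PT : probability Theta R)
  (GP : Theta -> linfty R F)
  (GP_measurable : measurable_fun setT (GP : Theta -> borel (linfty R F)))
  (GP_tight : tight_rv PT GP)
  (GP_separable : separable_rv PT GP)
  (GP_bridge : brownian_bridge P PT GP)
  (BL_measurable : forall n, measurable_fun setT
     (fun w : Omega n => BL_dist (PX n) (fun xi => Gt n (w, xi)) PT GP))
  (BL_marginal_measurable : forall n k (f : 'I_k -> F), measurable_fun setT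
     (fun w : Omega n =>
        BL_dist (PX n) (fun xi => marginal f (Gt n (w, xi)))
                PT (fun t => marginal f (GP t)))) :
  op1 PO (fun n w => BL_dist (PX n) (fun xi => Gt n (w, xi)) PT GP)
  <->
  (forall k (f : 'I_k -> F),
     op1 PO (fun n w =>
       BL_dist (PX n) (fun xi => marginal f (Gt n (w, xi)))
               PT (fun t => marginal f (GP t))))
  /\
  (forall eps eta : R, 0 < eps -> 0 < eta ->
     limn_esup (fun n =>
       PO n [set w | (eta%:E <
         PX n [set xi | (eps < modulus P delta (Gt n (w, xi)))%R])%E])
     @[delta --> 0^'+] --> 0%E).
Proof.
have mGt n w :
    measurable_fun setT ((fun xi => Gt n (w, xi)) : Xi n -> borel (linfty R F)).
  exact: (measurableT_comp (Gt_measurable n) (pair1_measurable w)).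
pose mod_prob n delta eps (w : Omega n) :=
  PX n [set xi | (eps < modulus P delta (Gt n (w, xi)))%R].
have mod_fin n delta eps w : mod_prob n delta eps w \is a fin_num.
  by apply: fin_num_measure; exact: modulus_set_measurable.
have mod_set n delta (eps eta : R) :
    measurable [set w | (eta%:E < mod_prob n delta eps w)%E].
  (* The conditional probability is the measure of a section of a jointly measurable set, hence
     measurable in [w]. *)
  pose S := [set z | eps < modulus P delta (Gt n z)].
  have mS : measurable S by exact: modulus_set_measurable.
  have E w : mod_prob n delta eps w = (PX n \o xsection S) w.
    by congr (PX n _); apply/seteqP; split=> xi; rewrite xsectionE/=.
  under eq_set do rewrite E.
  rewrite -[X in measurable X]setTI; apply: measurable_lte => //.
  exact: measurable_fun_xsection.
have mBL n (eps : R) (B : Omega n -> R) : measurable_fun setT B ->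
    measurable [set w | eps < `|B w|].
  by move=> mB; apply: measurable_ltr => //; exact: measurableT_comp.
split=> [BL0|[marg0 equi0]].
- split=> [k f eps eps0|eps eta eps0 eta0].
    apply: near_le_cvg0 => // e e0.
    apply: filterS (cvg0_near_lt (BL0 eps eps0) e0) => n /ltW.
    apply: le_trans; apply: le_measure; rewrite ?inE.
    - exact/mBL/BL_marginal_measurable.
    - exact/mBL/BL_measurable.
    move=> w /=; rewrite !ger0_norm.
    - by move=> /lt_le_trans; apply; exact: BL_dist_marginal_le.
    - exact: BL_dist_ge0.
    - by apply: BL_dist_ge0; exact: marginal_measurable.
  have e2 : 0 < eps / 2 by rewrite divr_gt0.
  have eta2 : 0 < eta / 2 by rewrite divr_gt0.
  have [d0 d0_gt0 mod_GP] :=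
    tight_modulus F_L2 GP_measurable GP_tight GP_bridge e2 eta2.
  (* For every positive [delta] up to [d0] the upper limit is exactly 0, so the function of [delta]
     is eventually constant. *)
  apply: cvg_near_cst; near=> delta.
  suff cvg0 :
      PO n [set w | (eta%:E < mod_prob n delta eps w)%E] @[n --> \oo] --> 0%E.
    rewrite (is_cvg_limn_esupE _); first exact: cvg_lim.
    by apply/cvg_ex; exists 0%E.
  pose c := Num.min 1 (eps / 4).
  have c0 : 0 < c by rewrite lt_min ltr01 divr_gt0.
  (* When the conditional probability exceeds [eta] and the bridge contributes at most [eta / 2],
     [modulus_prob_le] leaves more than [c * (eta / 2)] for the distance. *)
  have ce0 : 0 < c * (eta / 2) by rewrite mulr_gt0.
  apply: near_le_cvg0 => // e e_gt0.
  apply: filterS (cvg0_near_lt (BL0 _ ce0) e_gt0) => n /ltW.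
  apply: le_trans; apply: le_measure; rewrite ?inE.
  - exact: mod_set.
  - exact/mBL/BL_measurable.
  move=> w /=; rewrite -(fineK (mod_fin _ _ _ _)) lte_fin => etaw.
  rewrite ger0_norm; last exact: BL_dist_ge0.
  have := modulus_prob_le P (PX n) (mGt n w) PT GP_measurable delta eps0.
  rewrite -/c -/(mod_prob n delta eps w).
  have GPd : fine (PT [set t | eps / 2 < modulus P delta (GP t)]) <= eta / 2.
    have mset x : measurable [set t | eps / 2 < modulus P x (GP t)].
      exact: modulus_set_measurable.
    rewrite -lee_fin fineK ?fin_num_measure//.
    apply: le_trans mod_GP; apply: le_measure; rewrite ?inE//.
    move=> t /= /lt_le_trans; apply; apply: modulus_homo.
    by near: delta; exact: nbhs_right_le.
  nra.
- move=> eps eps0; apply: near_le_cvg0 => // e e0.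
  (* Off two bad events the approximation bound is at most [r] for the marginals plus [3 * r] for
     each process, that is [7 * r < eps]. *)
  pose r := eps / 8.
  have r0 : 0 < r by rewrite divr_gt0.
  have e2 : 0 < e / 2 by rewrite divr_gt0.
  have [d0 d0_gt0 mod_GP] :=
    tight_modulus F_L2 GP_measurable GP_tight GP_bridge r0 r0.
  have : \forall delta \near 0^'+, [/\ 0 < delta, delta <= d0 &
      (limn_esup (fun n => PO n [set w | (r%:E < mod_prob n delta r w)%E])
        < (e / 2)%:E)%E].
    near=> delta; split; near: delta.
    + exact: nbhs_right_gt.
    + exact: nbhs_right_le.
    + exact: cvg0_near_lt (equi0 r r r0 r0) e2.
  move=> /filter_ex[delta [delta0 dd0 /limn_esup_lt_near mod_near]].
  (* The net depends on [delta] alone, so condition (i) is applied to one fixed tuple as [n] grows.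
     Each bad event then has probability below [e / 2]. *)
  have [k [f [pi net]]] :=
    bridge_totally_bounded F_L2 GP_measurable GP_tight GP_bridge delta0.
  have marg_near := cvg0_near_lt (marg0 k f r r0) e2.
  apply: filterS2 mod_near marg_near => n modn margn.
  set W := [set w | _].
  pose W1 := [set w | (r%:E < mod_prob n delta r w)%E].
  pose W2 := [set w | r < `|BL_dist (PX n) (fun xi => marginal f (Gt n (w, xi)))
               PT (fun t => marginal f (GP t))|].
  have mW : measurable W by exact/mBL/BL_measurable.
  have mW1 : measurable W1 by exact: mod_set.
  have mW2 : measurable W2 by exact/mBL/BL_marginal_measurable.
  apply: (@le_trans _ _ (PO n (W1 `|` W2))).
    apply: le_measure; rewrite ?inE//; first exact: measurableU.
    move=> w; rewrite /W/= => epsw; apply: contrapT => /not_orP[].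
    rewrite /W1/W2/= => /negP; rewrite -leNgt -(fineK (mod_fin _ _ _ _)) lee_fin => w1.
    move=> /negP; rewrite -leNgt => w2.
    have := BL_dist_approx (PX n) (mGt n w) PT GP_measurable (ltW r0) net.
    rewrite -/(mod_prob n delta r w) leNgt => /negP; apply.
    rewrite ger0_norm in epsw; last exact: BL_dist_ge0.
    have GPd : fine (PT [set t | r < modulus P delta (GP t)]) <= r.
      have mset x : measurable [set t | r < modulus P x (GP t)].
        exact: modulus_set_measurable.
      rewrite -lee_fin fineK ?fin_num_measure//.
      apply: le_trans mod_GP; apply: le_measure; rewrite ?inE//.
      by move=> t /= /lt_le_trans; apply; exact: modulus_homo.
    apply: le_lt_trans epsw; have := le_trans (ler_norm _) w2.
    rewrite /r in w1 w2 GPd *; lra.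
  apply: (le_trans (measureU2 _ mW1 mW2)).
  by rewrite [e]splitr EFinD leeD// ltW.
Unshelve. all: by end_near. Qed.
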